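(* Let $k\geq 1$ and $n\geq \max\{6k^3,\,120k^2-180k+60\}$ be integers. Then every graph $F$ of order $n$ with $\delta(F)\geq n-k$ contains every connected graph $G$ with $n$ vertices, at most $n\left(1+\frac{1}{24k-12}\right)$ edges and $\Delta(G)<n\left(1-\frac{1}{24k-12}\right)$.
   Context: All graphs are finite and simple; the order of a graph is its number of vertices. $\delta(F)$ denotes the minimum degree of $F$ and $\Delta(G)$ the maximum degree of $G$. ''$F$ contains $G$'' means that $G$ is isomorphic to a (not necessarily induced) subgraph of $F$. *)

(* Defs.v *)
From mathcomp Require Import all_boot.

Set Implicit Arguments.
Unset Strict Implicit.
Unset Printing Implicit Defensive.

Record sgraph := SGraph {
  vertex :> finType;
  adj : rel vertex;
  adj_sym : symmetric adj;
  adj_irrefl : irreflexive adj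
}.

Definition edges (G : sgraph) : {set {set G}} :=
  [set [set x; y] | x in G, y in G & adj x y].

Definition degree (G : sgraph) (x : G) : nat := #|[set y | adj x y]|.

(* Every degree is smaller than #|G|, so the default value #|G| only matters
   for the graph without vertices. *)
Definition min_degree (G : sgraph) : nat :=
  \big[minn/#|G|]_(x : G) degree x.

Definition max_degree (G : sgraph) : nat := \max_(x : G) degree x.

Definition connected (G : sgraph) : Prop :=
  0 < #|G| /\ forall x y : G, connect (@adj G) x y.

(* A subgraph is an arbitrary set of vertices with an arbitrary set of edges
   of F between them; it need not be induced. *)
Record subgraph (F : sgraph) := Subgraph {
  sub_vertex : {set F};
  sub_adj : rel F;
  sub_adj_sym : symmetric sub_adj;
  sub_adjP : forall x y, sub_adj x y ->
    [/\ x \in sub_vertex, y \in sub_vertex & adj x y]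
}.

Section SubgraphGraph.
Variables (F : sgraph) (H : subgraph F).

Definition subgraph_adj : rel {x : F | x \in sub_vertex H} :=
  fun x y => sub_adj H (val x) (val y).

Fact subgraph_adj_sym : symmetric subgraph_adj.
Proof. by move=> x y; apply: sub_adj_sym. Qed.

Fact subgraph_adj_irrefl : irreflexive subgraph_adj.
Proof.
by move=> x; apply/negP => /sub_adjP[_ _]; rewrite adj_irrefl.
Qed.

Definition graph_of_subgraph : sgraph :=
  SGraph subgraph_adj_sym subgraph_adj_irrefl.
End SubgraphGraph.

Definition isomorphic (G H : sgraph) : Prop :=
  exists2 f : G -> H, bijective f & forall x y, adj (f x) (f y) = adj x y.

Definition contains (F G : sgraph) : Prop :=
  exists H : subgraph F, isomorphic G (graph_of_subgraph H).

(* Main.v *)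
Require Import Defs.
From mathcomp Require Import all_boot all_order all_algebra perm zify ring.
Import Order.TTheory GRing.Theory Num.Theory.

(** Write k = d + 1 and let h be non-adjacency in F, a relation in which every
vertex has at most d neighbors.  Then F contains G exactly when G can be packed
with h: some injection of G into F sends no edge of G to a pair related by h.

The idea is to set aside a set S of vertices of G of very small degree, to place
the other vertices one at a time, and to place S at the end.  Put n = #|G| and
E = n %/ (12 (2d + 1)), so that G has at most n + E edges.

Since G is connected, every set C of vertices spans at most #|C| + E edges.
Hence G is D-degenerate for some D of order sqrt E, and the greedy placement of
the vertices outside S succeeds as soon as d * D <= #|S|
([greedy_extension], [connected_degenerate]).  Three cases provide S.

- Some vertex u has d (D + d + 1) leaves around it.  Send u to any c and make
  all the h-neighbors of c images of pairwise nonadjacent nonneighbors of u; the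
  leaves at u can then go anywhere ([packing_from_star]).  The bound on the
  maximum degree leaves at least 5d nonneighbors of u, and they span at most
  about twice as many edges as they are, so a Turan-type bound finds d of them
  that are independent ([independent_nonneighbors]).

- Otherwise no vertex sees many leaves.  If there are many leaves in total, S
  is the set of leaves.

- If there are few leaves, there are few branch vertices, since the degrees
  average about 2.  So most vertices have degree at most 2 and no neighbor of
  degree above 4, and they contain a large independent set S ([card_low_set],
  [large_independent_set]).

In the last two cases every vertex of S forbids few places and every place is
forbidden to few vertices of S, and then a conflicting assignment of S can be
repaired by swaps ([swap_matching], [packing_from_spread_set]).  The cubic lower
bound on n makes the thresholds of the last two cases fit together
([order_large_enough]). *)

Set Implicit Arguments.
Unset Strict Implicit.
Unset Printing Implicit Defensive.

(** * Partial packings *)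

Lemma leq_card_bigcup (I T : finType) (A : {set I}) (F : I -> {set T}) c :
  (forall i, i \in A -> #|F i| <= c) -> #|\bigcup_(i in A) F i| <= #|A| * c.
Proof.
move=> Fc; rewrite -sum_nat_const.
elim/big_rec2: _ => [|i s X iA le_X]; first by rewrite cards0.
by rewrite (leq_trans (leq_card_setU _ _)) // leq_add // Fc.
Qed.

Definition packs_on (V W : finType) (e : rel V) (h : rel W)
    (A : {set V}) (f : V -> W) :=
  {in A &, injective f} /\ {in A &, forall x y, e x y -> ~~ h (f x) (f y)}.

(** The vertices of B outside A are placed so that each one sees at most D
vertices placed before it; each of these blocks d places, and fewer than #|B|
places are occupied. The order is found from its end: the vertex given by the
hypothesis for C = B :\: A is placed last. *)
Lemma greedy_extension (V W : finType) (e : rel V) (h : rel W) (d D : nat)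
    (A B : {set V}) (f : V -> W) :
  symmetric e -> irreflexive e -> symmetric h ->
  (forall w, #|[set w' | h w w']| <= d) -> A \subset B ->
  (forall C : {set V}, C != set0 -> C \subset B :\: A ->
     exists2 x, x \in C & #|[set y | e x y] :&: (A :|: C)| <= D) ->
  d * D + #|B| <= #|W| -> packs_on e h A f ->
  exists2 g, {in A, g =1 f} & packs_on e h B g.
Proof.
move=> e_sym e_irr h_sym h_deg + + + f_on_A.
have [m] := ubnP #|B :\: A|; elim: m B => // m IH B ltBm sAB B_degen B_small.
have [BA0|BA_n0] := eqVneq (B :\: A) set0.
  have -> : B = A by apply/eqP; rewrite eqEsubset sAB -setD_eq0 BA0 eqxx.
  by exists f.
have [x xBA x_deg] := B_degen _ BA_n0 (subxx _).
have [xA xB] : x \notin A /\ x \in B by move: xBA; rewrite !inE => /andP[].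
have AU : A :|: B :\: A = B.
  apply/setP => y; rewrite !inE.
  by case: (boolP (y \in A)) => // /(subsetP sAB).
rewrite AU in x_deg.
have cB : #|B| = #|B :\ x|.+1 by rewrite (cardsD1 x B) xB.
have cBA : #|(B :\ x) :\: A| < #|B :\: A|.
  by rewrite setDDl setUC -setDDl [X in _ < X](cardsD1 x) xBA.
have [||C C0 sC||g gf [g_inj g_pack]] := IH (B :\ x).
- by lia.
- by rewrite subsetD1 sAB xA.
- by apply: B_degen => //; rewrite (subset_trans sC) // setSD // subD1set.
- by lia.
pose N := [set y | e x y] :&: B.
pose Z := g @: (B :\ x) :|: \bigcup_(y in N) [set w | h (g y) w].
have /card_gt0P[w] : 0 < #|~: Z|.
  have Z1 : #|g @: (B :\ x)| <= #|B :\ x| := leq_imset_card _ _.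
  have Z2 : #|\bigcup_(y in N) [set w | h (g y) w]| <= #|N| * d.
    by apply: leq_card_bigcup.
  have Z3 : #|Z| <= #|B :\ x| + D * d.
    rewrite (leq_trans (leq_card_setU _ _)) // leq_add //.
    by rewrite (leq_trans Z2) // leq_mul2r x_deg orbT.
  by have := cardsC Z; lia.
rewrite !inE negb_or => /andP[w_new w_free].
have w_ok y : y \in B -> e x y -> ~~ h w (g y).
  move=> yB exy; apply: contra w_free; rewrite h_sym => hyw.
  by apply/bigcupP; exists y; rewrite !inE // exy.
have g_new y : y \in B -> y != x -> g y != w.
  move=> yB yx; apply: contraNneq w_new => <-.
  by apply: imset_f; rewrite !inE yx.
exists (fun v => if v == x then w else g v) => [y yA|].
  by case: eqP => [yx|_]; [rewrite -yx yA in xA | apply: gf].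
split=> y z yB zB;
  case: (eqVneq y x) => [->|yx]; case: (eqVneq z x) => [->|zx] //.
- by move=> wg; move: (g_new z zB zx); rewrite -wg eqxx.
- by move=> wg; move: (g_new y yB yx); rewrite wg eqxx.
- by apply: g_inj; rewrite !inE ?yx ?zx.
- by rewrite e_irr.
- exact: w_ok.
- by rewrite e_sym h_sym; apply: w_ok.
- by apply: g_pack; rewrite !inE ?yx ?zx.
Qed.

(** Greedy placement for the relations without pairs. *)
Lemma extend_injection (V W : finType) (A : {set V}) (f : V -> W) :
  #|V| <= #|W| -> {in A &, injective f} ->
  exists2 g, {in A, g =1 f} & injective g.
Proof.
move=> leVW f_inj.
have no_nbr (T : finType) (X : {set T}) : #|[set _ : T | false] :&: X| <= 0.
  by rewrite leqn0 cards_eq0; apply/eqP/setP => x; rewrite !inE.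
case: (@greedy_extension V W (fun _ _ => false) (fun _ _ => false)
         0 0 A setT f) => // [|C /set0Pn[x xC] _||g gf [g_inj _]].
- by move=> w; have := no_nbr W setT; rewrite setIT.
- by exists x.
- by rewrite cardsT.
by exists g => // x y; apply: g_inj; rewrite inE.
Qed.

(** If v sits at a forbidden place, at most a + b - 1 vertices u are unsuitable
for an exchange with v: at most a whose place is forbidden to v, at most b to
which the place of v is forbidden, and v itself belongs to both kinds. So an
exchange that repairs v without harming anyone exists, and the number of
conflicts decreases. *)
Lemma swap_matching (V W : finType) (S : {set V}) (forb : V -> W -> bool)
    (a b : nat) (f : V -> W) :
  injective f ->
  (forall v, v \in S -> #|[set w in f @: S | forb v w]| <= a) ->
  (forall w, w \in f @: S -> #|[set v in S | forb v w]| <= b) ->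
  a + b <= #|S| ->
  exists g, [/\ injective g, {in ~: S, g =1 f}
              & {in S, forall v, ~~ forb v (g v)}].
Proof.
move=> + + + leabS; have [m] := ubnP #|[set v in S | forb v (f v)]|.
elim: m f => // m IH f lt_m f_inj fa fb.
have [bad0|/set0Pn[v]] := eqVneq [set v in S | forb v (f v)] set0.
  exists f; split=> // v vS; apply/negP => bad.
  by have := in_set0 v; rewrite -bad0 inE vS bad.
rewrite inE => /andP[vS bad].
pose Z1 := [set u in S | forb v (f u)].
pose Z2 := [set u in S | forb u (f v)].
have cZ1 : #|Z1| <= a.
  rewrite -(card_imset _ f_inj) (leq_trans _ (fa v vS)) // subset_leq_card //.
  apply/subsetP => _ /imsetP[u + ->]; rewrite !inE => /andP[uS ->].
  by rewrite imset_f.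
have cZ2 : #|Z2| <= b by apply: fb; rewrite imset_f.
have [u uS] : exists2 u, u \in S & u \notin Z1 :|: Z2.
  apply/subsetPn; apply/negP => /subset_leq_card.
  have : 0 < #|Z1 :&: Z2|.
    by apply/card_gt0P; exists v; rewrite !inE vS bad.
  by rewrite cardsU; have := subset_leq_card (subsetIl Z1 Z2); lia.
rewrite !inE uS negb_or /= => /andP[vu uv].
have tS x : (tperm v u x \in S) = (x \in S).
  by case: tpermP => [->|->|//]; rewrite ?uS ?vS.
have imS : (f \o tperm v u) @: S = f @: S.
  apply/setP => w; apply/imsetP/imsetP => -[x xS ->] /=.
    by exists (tperm v u x); rewrite ?tS.
  by exists (tperm v u x); rewrite ?tS //= tpermK.
have [||||g [g_inj gf g_ok]] := IH (f \o tperm v u).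
- suff : #|[set x in S | forb x ((f \o tperm v u) x)]|
         < #|[set x in S | forb x (f x)]| by lia.
  apply/proper_card/properP; split.
    apply/subsetP => x; rewrite !inE /= => /andP[-> /=].
    by case: tpermP => [->|->|//]; rewrite ?(negPf vu) ?(negPf uv).
  by exists v; rewrite !inE ?vS ?bad //= tpermL (negPf vu).
- exact: inj_comp f_inj perm_inj.
- by rewrite imS.
- by rewrite imS.
exists g; split=> // x xS; rewrite gf //= tpermD //.
  by apply: contraTneq xS => <-; rewrite inE vS.
by apply: contraTneq xS => <-; rewrite inE uS.
Qed.

(** * Neighborhoods, degree sums and degeneracy *)

Definition neighbors (G : sgraph) (x : G) : {set G} := [set y | adj x y].

(** Twice the number of edges spanned by A. *)
Definition degree_sum (G : sgraph) (A : {set G}) : nat :=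
  \sum_(x in A) #|neighbors x :&: A|.

Definition independent (G : sgraph) (A : {set G}) : Prop :=
  {in A &, forall x y, ~~ adj x y}.

Definition degenerate (G : sgraph) (D : nat) : Prop :=
  forall C : {set G}, C != set0 ->
    exists2 x, x \in C & #|neighbors x :&: C| <= D.

Lemma degree_sum_setT (G : sgraph) :
  degree_sum [set: G] = \sum_(x : G) degree x.
Proof.
by apply: eq_big => x; rewrite ?inE // setIT.
Qed.

(** Each edge is the set of ends of at most two ordered pairs. *)
Lemma sum_degree_le (G : sgraph) : \sum_(x : G) degree x <= 2 * #|edges G|.
Proof.
pose P := [set p : G * G | adj p.1 p.2].
have -> : \sum_(x : G) degree x = #|P|.
  rewrite -sum1_card (eq_bigl (fun p : G * G => adj p.1 p.2)); last first.
    by move=> p; rewrite inE.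
  rewrite -(pair_big_dep xpredT (fun x y => adj x y) (fun _ _ => 1)) /=.
  by apply: eq_bigr => x _; rewrite sum1_card /degree cardsE.
pose ends (p : G * G) := [set p.1; p.2].
have ends_edge p : p \in P -> ends p \in edges G.
  by rewrite inE => ap; apply/imset2P; exists p.1 p.2; rewrite ?inE.
rewrite -sum1_card (partition_big ends (mem (edges G))) //=.
rewrite mulnC -sum_nat_const; apply: leq_sum => _ /imset2P[a b _ _ ->].
rewrite sum1_card -[X in _ <= X]/(1 + 1) -{1}(cards1 (a, b)) -(cards1 (b, a)).
apply: leq_trans (leq_card_setU _ _); apply/subset_leq_card/subsetP => -[x y].
rewrite 3!inE => /andP[]; rewrite inE => /= axy /eqP /setP E.
have xy : x != y by apply: contraTneq axy => ->; rewrite adj_irrefl.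
have := E x; have := E y; rewrite !inE !eqxx /= ?orbT => /esym ya /esym xa.
case/orP: xa xy => /eqP->; case/orP: ya => /eqP->; rewrite ?eqxx ?orbT //.
Qed.

Lemma boundary_edge (G : sgraph) (A : {set G}) :
  connected G -> A != set0 -> A != setT ->
  exists x y, [/\ x \in A, y \notin A & adj x y].
Proof.
move=> [_ conn] /set0Pn[x xA] AT.
have /subsetPn[y _ yA] : ~~ ([set: G] \subset A) by rewrite subTset.
have [/existsP[u /existsP[v /and3P[]]]|noedge] :=
  boolP [exists u, exists v, [&& u \in A, v \notin A & adj u v]].
  by exists u, v.
have out u v : u \in A -> adj u v -> v \in A.
  move=> uA auv; apply: contraNT noedge => vA.
  by apply/existsP; exists u; apply/existsP; exists v; apply/and3P.
have Acl : closed (@adj G) A.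
  move=> u v auv; apply/idP/idP => [uA|vA]; first exact: out auv.
  by apply: out vA _; rewrite adj_sym.
by have := closed_connect Acl (conn x y); rewrite xA (negPf yA).
Qed.

(** In a connected graph A can be enlarged vertex by vertex, each new vertex
being adjacent to an old one, so each brings at least one new edge: the excess
of edges over vertices never decreases. *)
Lemma degree_sum_grow (G : sgraph) (A : {set G}) :
  connected G -> A != set0 ->
  degree_sum A + 2 * #|~: A| <= degree_sum [set: G].
Proof.
move=> conn; have [m] := ubnP #|~: A|; elim: m A => // m IH A ltm A0.
have [->|AT] := eqVneq A setT; first by rewrite setCT cards0 addn0.
have [x [y [xA yA axy]]] := boundary_edge conn A0 AT.
have cA : #|~: A| = #|~: (y |: A)|.+1.
  by rewrite (cardsD1 y) inE yA setCU setIC -setDE.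
have yA0 : y |: A != set0 by apply/set0Pn; exists y; rewrite setU11.
have := IH (y |: A) ltac:(lia) yA0.
suff : degree_sum A + 2 <= degree_sum (y |: A) by lia.
rewrite /degree_sum big_setU1 //= !(big_setD1 x xA) /=.
have ynbr : 0 < #|neighbors y :&: (y |: A)|.
  by apply/card_gt0P; exists x; rewrite !inE xA orbT andbT adj_sym.
have xnbr : #|neighbors x :&: A| < #|neighbors x :&: (y |: A)|.
  apply/proper_card/properP; split; first exact/setIS/subsetUr.
  by exists y; rewrite !inE ?eqxx ?axy // (negPf yA).
have rest : \sum_(i in A :\ x) #|neighbors i :&: A|
   <= \sum_(i in A :\ x) #|neighbors i :&: (y |: A)|.
  by apply: leq_sum => i _; apply/subset_leq_card/setIS/subsetUr.
lia.
Qed.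

(** A set C in which all degrees exceed D has more than D + 1 vertices and spans
at least #|C| (D + 1) / 2 edges, whereas [degree_sum_grow] allows it at most
#|C| + E. *)
Lemma connected_degenerate (G : sgraph) (E D : nat) :
  connected G -> \sum_(x : G) degree x <= 2 * #|G| + 2 * E ->
  2 * E + 2 < D * D.+1 -> degenerate G D.
Proof.
move=> conn leE leD C C0.
have [/existsP[x /andP[]]|] :=
  boolP [exists x, (x \in C) && (#|neighbors x :&: C| <= D)]; first by exists x.
rewrite negb_exists => /forallP big; exfalso.
have bigC x : x \in C -> D < #|neighbors x :&: C|.
  by move=> xC; have := big x; rewrite xC /= -ltnNge.
have [x xC] := set0Pn _ C0.
have C_big : D.+1 < #|C|.
  rewrite (cardsD1 x) xC; apply: leq_trans (bigC x xC) _.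
  apply/subset_leq_card/subsetP => y; rewrite !inE => /andP[axy ->].
  by rewrite andbT; apply: contraTneq axy => ->; rewrite adj_irrefl.
have low : #|C| * D.+1 <= degree_sum C.
  by rewrite -sum_nat_const; apply: leq_sum.
have := degree_sum_grow conn C0; have := cardsC C; rewrite degree_sum_setT.
nia.
Qed.

(** The Turan bound near average degree 4, in linear form (equality for disjoint
copies of K_4 and K_5). Take a vertex v of minimum degree r within A and delete
its closed neighborhood: this loses r + 1 vertices and at least r (r + 1) from
the degree sum, and 8 (r + 1) <= 20 + r (r + 1) since (r - 3) (r - 4) >= 0. *)
Lemma large_independent_set (G : sgraph) (A : {set G}) :
  exists X : {set G},
    [/\ X \subset A, independent X & 8 * #|A| <= 20 * #|X| + degree_sum A].
Proof.
have [m] := ubnP #|A|; elim: m A => // m IH A ltm.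
have [->|/set0Pn[v0 v0A]] := eqVneq A set0.
  exists set0; rewrite sub0set cards0; split=> // x y; by rewrite inE.
have [v vA v_min] := arg_minnP (fun v => #|neighbors v :&: A|) v0A.
have {}vA : v \in A by [].
set r := #|neighbors v :&: A| in v_min.
pose N := v |: neighbors v :&: A.
have cN : #|N| = r.+1 by rewrite cardsU1 !inE adj_irrefl.
have sNA : N \subset A by rewrite subUset sub1set vA subsetIr.
have cA : #|A| = #|N| + #|A :\: N|.
  by rewrite cardsDS // subnKC ?subset_leq_card.
have [|X [sX X_ind X_large]] := IH (A :\: N); first by lia.
have /subsetDP[sXA /disjointFr X_N] := sX.
have vX : v \notin X by apply/negP => /X_N; rewrite setU11.
have X_v x : x \in X -> ~~ adj v x.
  move=> xX; have := X_N x xX.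
  by rewrite !inE (subsetP sXA) // andbT => /negbT/norP[].
exists (v |: X); split; first by rewrite subUset sub1set vA.
  move=> x y; rewrite !inE => /predU1P[->|xX] /predU1P[->|yX].
  - by rewrite adj_irrefl.
  - exact: X_v.
  - by rewrite adj_sym X_v.
  - exact: X_ind.
have dsum : degree_sum (A :\: N) + r.+1 * r <= degree_sum A.
  rewrite /degree_sum [in leqRHS](big_setID N) /= (setIidPr sNA).
  rewrite addnC leq_add //.
    rewrite -cN -sum_nat_const; apply: leq_sum => x xN.
    by apply: v_min; apply: (subsetP sNA).
  by apply: leq_sum => x _; apply/subset_leq_card/setIS/subsetDl.
rewrite cardsU1 vX /=.
have : r <= 3 \/ 4 <= r by lia.
by case=> ?; nia.
Qed.

(** * Packings completed on a set of low-degree vertices *)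

Lemma degenerate_back_degree (G : sgraph) (D : nat) (A C : {set G}) :
  degenerate G D -> C != set0 ->
  exists2 x, x \in C & #|neighbors x :&: (A :|: C)| <= #|A| + D.
Proof.
move=> degen /degen[x xC x_deg]; exists x => //.
rewrite setIUr (leq_trans (leq_card_setU _ _)) // leq_add //.
exact/subset_leq_card/subsetIr.
Qed.

(** After greedy placement of the complement, a vertex of S has at most c placed
neighbors, hence at most c * d forbidden places; a place conflicts with at most
d placed vertices, each with at most T neighbors in S. *)
Lemma packing_from_spread_set (G : sgraph) (W : finType) (h : rel W)
    (d D c T : nat) (S : {set G}) :
  #|W| = #|G| -> symmetric h -> (forall w, #|[set w' | h w w']| <= d) ->
  degenerate G D -> independent S ->
  {in S, forall v, degree v <= c} ->
  (forall u : G, #|neighbors u :&: S| <= T) ->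
  d * (c + T) <= #|S| -> d * D <= #|S| ->
  exists f : G -> W, packs_on (@adj G) h setT f.
Proof.
move=> cW h_sym h_deg degen S_ind S_deg S_spread S_large S_room.
pose f0 x : W := enum_val (cast_ord (esym cW) (enum_rank (x : G))).
case: (@greedy_extension G W (@adj G) h d D set0 (~: S) f0) => //.
- exact: adj_sym.
- exact: adj_irrefl.
- exact: sub0set.
- move=> C C0 _; have := degenerate_back_degree set0 degen C0.
  by rewrite cards0.
- by have := cardsC S; lia.
- by split=> x; rewrite inE.
move=> f1 _ [f1_inj f1_pack].
have leGW : #|G| <= #|W| by rewrite cW.
have [f f_f1 f_inj] := extend_injection leGW f1_inj.
have f_pack : {in ~: S &, forall x y, adj x y -> ~~ h (f x) (f y)}.
  by move=> x y xS yS axy; rewrite !f_f1 //; apply: f1_pack.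
pose forb (v : G) w := [exists u, adj v u && h (f u) w].
(* forb v w: putting v at w would clash with a neighbor of v already placed. *)
case: (@swap_matching G W S forb (c * d) (d * T) f) => //.
- move=> v vS; apply: (@leq_trans (degree v * d)); last first.
    by rewrite leq_mul2r S_deg ?orbT.
  apply: leq_trans (leq_card_bigcup (A := neighbors v)
    (F := fun u => [set w | h (f u) w]) _) => //.
  apply/subset_leq_card/subsetP => w; rewrite inE => /andP[_].
  by case/existsP=> u /andP[vu uw]; apply/bigcupP; exists u; rewrite inE.
- move=> w _; pose U := [set u | h (f u) w].
  have cU : #|U| <= d.
    rewrite -(card_imset _ f_inj); apply: leq_trans (h_deg w).
    apply/subset_leq_card/subsetP => _ /imsetP[u + ->].
    by rewrite !inE h_sym.
  apply: (@leq_trans (#|U| * T)); last by rewrite leq_mul2r cU orbT.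
  apply: leq_trans (leq_card_bigcup (A := U)
    (F := fun u => neighbors u :&: S) _) => //.
  apply/subset_leq_card/subsetP => v; rewrite inE => /andP[vS].
  case/existsP=> u /andP[vu uw]; apply/bigcupP; exists u; rewrite ?inE //.
  by rewrite vS adj_sym vu.
- by rewrite [c * d]mulnC -mulnDr.
move=> g [g_inj g_f g_ok]; exists g; split=> [x y _ _|]; first exact: g_inj.
have g_pack_S v y : v \in S -> adj v y -> ~~ h (g y) (g v).
  move=> vS avy; have yS : y \notin S by apply: contraL avy => yS; apply: S_ind.
  rewrite (g_f y) ?inE //; apply: contra (g_ok v vS) => hyv.
  by apply/existsP; exists y; rewrite avy.
move=> x y _ _ axy.
have [xS|xS] := boolP (x \in S); first by rewrite h_sym; apply: g_pack_S.
have [yS|yS] := boolP (y \in S); first by apply: g_pack_S; rewrite // adj_sym.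
by rewrite !g_f ?inE //; apply: f_pack; rewrite ?inE.
Qed.

Lemma bijection_between (V W : finType) (X : {set V}) (Z : {set W}) (w0 : W) :
  #|X| = #|Z| -> exists2 f : V -> W, {in X &, injective f} & f @: X = Z.
Proof.
move=> cXZ; pose f x := nth w0 (enum Z) (index x (enum X)).
have lt_ix x : x \in X -> index x (enum X) < size (enum Z).
  by move=> xX; rewrite -cardE -cXZ cardE index_mem mem_enum.
have f_inj : {in X &, injective f}.
  move=> x y xX yX /eqP.
  rewrite nth_uniq ?enum_uniq ?lt_ix // => /eqP/index_inj.
  by rewrite !mem_enum; apply.
exists f => //; apply/eqP; rewrite eqEcard card_in_imset // cXZ leqnn andbT.
by apply/subsetP => _ /imsetP[x xX ->]; rewrite -mem_enum mem_nth ?lt_ix.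
Qed.

(** Once u is placed at c, only the at most d places related to c are bad for
the leaves at u. They are filled beforehand by vertices of X, which causes no
conflict because X is independent and not adjacent to u. Every later vertex
then sees at most d + 1 more placed vertices than its degeneracy bound. *)
Lemma packing_from_star (G : sgraph) (W : finType) (h : rel W)
    (d D : nat) (u : G) (X : {set G}) :
  #|W| = #|G| -> symmetric h -> irreflexive h ->
  (forall w, #|[set w' | h w w']| <= d) -> degenerate G D ->
  d * (D + d + 1) <= #|[set v in neighbors u | degree v == 1]| ->
  independent X -> u \notin X -> {in X, forall x, ~~ adj u x} -> d <= #|X| ->
  exists f : G -> W, packs_on (@adj G) h setT f.
Proof.
move=> cW h_sym h_irr h_deg degen; set L := [set v in _ | _] => L_large.
move=> X_ind uX X_u X_large.
have /card_gt0P[c _] : 0 < #|W| by rewrite cW; apply/card_gt0P; exists u.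
have L_nbr v y : v \in L -> adj v y -> y = u.
  rewrite !inE => /andP[auv /cards1P[z vz]] avy.
  have /set1P -> : y \in [set z] by rewrite -vz inE.
  by apply/esym/set1P; rewrite -vz inE adj_sym.
(* X may be larger than the set of h-neighbors of c; only a part is used. *)
have [X' sX' cX'] : exists2 X' : {set G}, X' \subset X &
    #|X'| = #|[set w | h c w]|.
  exists [set x in take #|[set w | h c w]| (enum X)].
    by apply/subsetP => x; rewrite inE => /mem_take; rewrite mem_enum.
  rewrite cardsE (card_uniqP _) ?take_uniq ?enum_uniq // size_take -cardE.
  by case: ltnP => //; have := h_deg c; lia.
have [f0 f0_inj f0_im] := bijection_between c cX'.
have uX' : u \notin X' by apply: contra uX; apply/subsetP.
pose f1 x := if x == u then c else f0 x.
have f1X x : x \in X' -> f1 x = f0 x.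
  by move=> xX; rewrite /f1; case: eqP => // xu; rewrite -xu xX in uX'.
have f1u : f1 u = c by rewrite /f1 eqxx.
have c_f0 x : x \in X' -> f0 x != c.
  move=> xX; apply/negP => /eqP xc.
  have : f0 x \in [set w | h c w] by rewrite -f0_im imset_f.
  by rewrite inE xc h_irr.
case: (@greedy_extension G W (@adj G) h d (D + d + 1)
         (u |: X') (~: L) f1) => //.
- exact: adj_sym.
- exact: adj_irrefl.
- rewrite subUset sub1set !inE adj_irrefl /=; apply/subsetP => x xX.
  by rewrite !inE (negPf (X_u x _)) //; apply: (subsetP sX').
- move=> C C0 _; have [x xC x_deg] := degenerate_back_degree (u |: X') degen C0.
  exists x => //; apply: leq_trans x_deg _.
  by rewrite cardsU1 uX' cX'; have := h_deg c; lia.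
- by have := cardsC L; lia.
- split=> x y /setU1P[->|xX] /setU1P[->|yX];
    rewrite ?f1u ?f1X // ?adj_irrefl //.
  + by move=> cy; have := c_f0 y yX; rewrite -cy eqxx.
  + by move=> xc; have := c_f0 x xX; rewrite xc eqxx.
  + exact: f0_inj.
  + by rewrite (negPf (X_u y _)) //; apply: (subsetP sX').
  + by rewrite adj_sym (negPf (X_u x _)) //; apply: (subsetP sX').
  + by rewrite (negPf (X_ind _ _ _ _)) //; apply: (subsetP sX').
move=> f2 f2_f1 [f2_inj f2_pack].
have leGW : #|G| <= #|W| by rewrite cW.
have [g g_f2 g_inj] := extend_injection leGW f2_inj.
have uL : u \notin L by rewrite !inE adj_irrefl.
have X'L x : x \in X' -> x \notin L.
  by move=> xX; rewrite !inE (negPf (X_u x _)) //; apply: (subsetP sX').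
have g_f1 x : x \notin L -> x \in u |: X' -> g x = f1 x.
  by move=> xL xA; rewrite g_f2 ?in_setC // f2_f1.
have gu : g u = c by rewrite g_f1 ?setU11.
have g_L v : v \in L -> ~~ h c (g v).
  move=> vL; apply/negP => hcv.
  have : g v \in f0 @: X' by rewrite f0_im inE.
  case/imsetP=> x xX gvx; have xL := X'L x xX.
  have gx : g x = f0 x by rewrite g_f1 ?setU1r // f1X.
  by move: xL; rewrite -(g_inj _ _ (etrans gvx (esym gx))) vL.
exists g; split=> [x y _ _|x y _ _ axy]; first exact: g_inj.
have [xL|xL] := boolP (x \in L).
  by rewrite (L_nbr x y xL axy) h_sym gu g_L.
have [yL|yL] := boolP (y \in L).
  by rewrite (L_nbr y x yL) 1?adj_sym // gu g_L.
by rewrite !g_f2 ?in_setC //; apply: f2_pack; rewrite ?in_setC.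
Qed.

(** * Sparse connected graphs *)

Lemma connected_degree_gt0 (G : sgraph) (x : G) :
  connected G -> 1 < #|G| -> 0 < degree x.
Proof.
move=> conn G_gt1.
have x0 : [set x] != set0 by apply/set0Pn; exists x; rewrite inE.
have xT : [set x] != setT.
  by apply/eqP => xT; move: G_gt1; rewrite -cardsT -xT cards1.
have [y [z [/set1P-> _ xz]]] := boundary_edge conn x0 xT.
by apply/card_gt0P; exists z; rewrite inE.
Qed.

Lemma leaves_independent (G : sgraph) :
  connected G -> 2 < #|G| -> independent [set x : G | degree x == 1].
Proof.
move=> conn G_gt2 x y; rewrite !inE => /cards1P[x' xx'] /cards1P[y' yy'].
apply/negP => xy.
have A0 : [set x; y] != set0 by apply/set0Pn; exists x; rewrite !inE eqxx.
have AT : [set x; y] != setT.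
  apply/eqP => AT; move: G_gt2; rewrite -cardsT -AT cards2; by case: eqP.
have nx z : adj x z -> z = y.
  move=> xz; have : z \in [set x'] by rewrite -xx' inE.
  have : y \in [set x'] by rewrite -xx' inE.
  by move=> /set1P-> /set1P->.
have ny z : adj y z -> z = x.
  move=> yz; have : z \in [set y'] by rewrite -yy' inE.
  have : x \in [set y'] by rewrite -yy' inE adj_sym.
  by move=> /set1P-> /set1P->.
have [u [v [uA vA uv]]] := boundary_edge conn A0 AT.
by move: vA; case/set2P: uA uv => -> => [/nx|/ny] ->; rewrite !inE eqxx ?orbT.
Qed.

(** Let Y be the set of nonneighbors of u, so degree u + #|Y| + 1 = n. The
vertices outside Y contribute at least 2 * degree u to the degree sum of G, so
that degree_sum Y <= 2 #|Y| + 2 + 2 E <= 4 #|Y| + 2. Then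
[large_independent_set] yields 20 #|X| >= 4 #|Y| - 2 >= 20 d - 2, which is
enough because #|X| is an integer. *)
Lemma independent_nonneighbors (G : sgraph) (E d : nat) (u : G) :
  connected G -> 1 < #|G| -> \sum_(x : G) degree x <= 2 * #|G| + 2 * E ->
  degree u + E + 1 <= #|G| -> degree u + 5 * d + 1 <= #|G| ->
  exists X : {set G}, [/\ independent X, u \notin X,
    {in X, forall x, ~~ adj u x} & d <= #|X|].
Proof.
move=> conn G_gt1 leE leu led.
pose Y := ~: (u |: neighbors u).
have cY : degree u + #|Y| + 1 = #|G|.
  have := cardsC (u |: neighbors u).
  by rewrite cardsU1 inE adj_irrefl /= -/(degree u) -/Y; lia.
have [X [sXY X_ind X_large]] := large_independent_set Y.
exists X; split=> //.
- by apply/negP => /(subsetP sXY); rewrite !inE eqxx.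
- by move=> x /(subsetP sXY); rewrite !inE => /norP[].
have sumY : degree_sum Y <= \sum_(x in Y) degree x.
  by apply: leq_sum => x _; apply/subset_leq_card/subsetIl.
have sumN : degree u <= \sum_(x in neighbors u) degree x.
  rewrite -[degree u]muln1 -sum_nat_const; apply: leq_sum => x _.
  exact: connected_degree_gt0.
have : \sum_(x : G) degree x = \sum_(x in Y) degree x + degree u
          + \sum_(x in neighbors u) degree x.
  rewrite (bigID (mem Y)) /= -addnA; congr (_ + _).
  rewrite -(big_setU1 _ _) ?inE ?adj_irrefl //.
  by apply: eq_bigl => x; rewrite in_setC negbK.
lia.
Qed.

(** Degree 4 is the least cutoff for which the charging argument of
[card_low_set] costs at most twice the surplus degree. *)
Definition low_set (G : sgraph) : {set G} :=
  [set x | (degree x <= 2) && [forall y, adj x y ==> (degree y <= 4)]].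

(** A vertex x is charged with the vertices it keeps out of the low set: itself
if its degree exceeds 2, its neighbors if its degree exceeds 4. The charge is at
most 2 (degree x - 2), up to a correction of 2 for leaves, and the surpluses
degree x - 2 sum up to at most 2 E. *)
Lemma card_low_set (G : sgraph) (E : nat) :
  connected G -> 1 < #|G| -> \sum_(x : G) degree x <= 2 * #|G| + 2 * E ->
  #|G| <= #|low_set G| + 2 * #|[set x : G | degree x == 1]| + 4 * E.
Proof.
move=> conn G_gt1 leE.
pose F (x : G) := (if 2 < degree x then [set x] else set0) :|:
                  (if 4 < degree x then neighbors x else set0).
have cost x : #|F x| + 4 <= 2 * degree x + 2 * (degree x == 1).
  have d0 := connected_degree_gt0 x conn G_gt1.
  have [+ _] := leq_card_setU (if 2 < degree x then [set x] else set0)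
                  (if 4 < degree x then neighbors x else set0).
  have nbrE : #|neighbors x| = degree x by [].
  rewrite -/(F x); case: ltnP => d2; case: ltnP => d4; case: eqP => d1;
    rewrite ?cards1 ?cards0 ?nbrE /=; lia.
have sF : ~: low_set G \subset \bigcup_x F x.
  apply/subsetP => x; rewrite !inE negb_and -ltnNge => /orP[x2|].
    by apply/bigcupP; exists x => //; rewrite inE x2 set11.
  rewrite negb_forall => /existsP[y].
  rewrite negb_imply -ltnNge => /andP[xy y4].
  by apply/bigcupP; exists y => //; rewrite inE y4 !inE adj_sym xy orbT.
have cF : #|~: low_set G| <= \sum_(x : G) #|F x|.
  apply: leq_trans (subset_leq_card sF) _.
  elim/big_rec2: _ => [|i s X _ le_X]; first by rewrite cards0.
  by rewrite (leq_trans (leq_card_setU _ _)) // leq_add2l.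
have n1 : #|[set x : G | degree x == 1]| = \sum_(x : G) (degree x == 1).
  rewrite -sum1_card big_mkcond; apply: eq_bigr => x _.
  by rewrite inE; case: eqP.
have : \sum_(x : G) (#|F x| + 4)
   <= \sum_(x : G) (2 * degree x + 2 * (degree x == 1)).
  by apply: leq_sum.
rewrite !big_split /= sum_nat_const !big1_eq -n1.
rewrite -!(cardsC (low_set G)) in leE *; lia.
Qed.

(** D is the quotient of 2E + 2 + (d + 1)^2 by 2d + 1. It replaces a square root
of 2E + 2 by a linear expression in E, the arithmetic-geometric mean inequality
being used around d + 1, which is the right order of magnitude of sqrt E when
n is close to 6 (d + 1)^3. For t = D + 1 the argument is
t (2d + 1) <= t^2 - t + (d + 1)^2. *)
Lemma degeneracy_bound_exists (d E : nat) : exists D : nat,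
  2 * E + 2 < D * D.+1 /\ D * (2 * d + 1) <= 2 * E + 2 + (d + 1) ^ 2.
Proof.
pose N := 2 * E + 2 + (d + 1) ^ 2.
have D_gt : N < (N %/ (2 * d + 1)).+1 * (2 * d + 1).
  by rewrite ltn_ceil // addn1.
exists (N %/ (2 * d + 1)); split; last exact: leq_divM.
move: D_gt; rewrite {1}/N; set D := N %/ _; clearbody D.
by case: (leqP D d) => ? ?; nia.
Qed.

(** The sum of the three needs of the last case: six times the number of leaves
below which that case applies, twelve times the excess, and ten times the
required size of S. *)
Lemma order_large_enough (n d E D : nat) :
  D * (2 * d + 1) <= 2 * E + 2 + (d + 1) ^ 2 ->
  12 * (2 * d + 1) * E <= n -> 6 * (d + 1) ^ 3 <= n ->
  60 * (2 * d + 1) * d <= n ->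
  6 * (d * (d * (D + d + 1))) + 12 * E + 10 * (d * (D + 6)) <= 3 * n.
Proof.
move=> D_le E_small n_cubic n_quad.
case: d => [|d] in D_le E_small n_cubic n_quad *; first by lia.
move: D_le E_small n_cubic n_quad; set p := d.+1 => D_le E_small n_cubic n_quad.
have p_gt0 : 0 < p by [].
clearbody p; clear d.
have E36 : 36 * E <= n by nia.
(* D_le times 3p + 4, because 6p^2 + 10p <= (3p + 4) (2p + 1). *)
have D_bound :
  (6 * p ^ 2 + 10 * p) * D <= (3 * p + 4) * (2 * E + 2 + (p + 1) ^ 2).
  apply: leq_trans (leq_mul (leqnn (3 * p + 4)) D_le).
  by rewrite mulnCA [leqRHS]mulnC leq_mul2r; apply/orP; right; nia.
nia.
Qed.

(** The three cases on leaves. The last hypothesis says that more than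
n / (12 (2d + 1)) vertices, hence more than E and more than 5d of them, are
equal or not adjacent to u. *)
Lemma sparse_connected_packing (G : sgraph) (W : finType) (h : rel W)
    (d E : nat) :
  connected G -> 2 < #|G| -> #|W| = #|G| -> symmetric h -> irreflexive h ->
  (forall w, #|[set w' | h w w']| <= d) ->
  \sum_(x : G) degree x <= 2 * #|G| + 2 * E ->
  12 * (2 * d + 1) * E <= #|G| ->
  6 * (d + 1) ^ 3 <= #|G| -> 60 * (2 * d + 1) * d <= #|G| ->
  (forall u : G, #|G| < 12 * (2 * d + 1) * (#|G| - degree u)) ->
  exists f : G -> W, packs_on (@adj G) h setT f.
Proof.
move=> conn G_gt2 cW h_sym h_irr h_deg leE; set n := #|G| in leE *.
move=> E_small n_cubic n_quad deg_lt.
have G_gt1 : 1 < #|G| by apply: ltnW.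
have [D [D_gt D_le]] := degeneracy_bound_exists d E.
have degen : degenerate G D := connected_degenerate conn leE D_gt.
have room := order_large_enough D_le E_small n_cubic n_quad.
pose leaves := [set x : G | degree x == 1].
have [star|no_star] := boolP [exists u : G,
    d * (D + d + 1) <= #|[set v in neighbors u | degree v == 1]|].
  case/existsP: star => u u_star; have deg_u := deg_lt u.
  have far m : 12 * (2 * d + 1) * m <= n -> degree u + m + 1 <= n.
    by move=> le_m; have := leq_ltn_trans le_m deg_u; rewrite ltn_pmul2l; lia.
  have n_quad5 : 12 * (2 * d + 1) * (5 * d) <= n by lia.
  have [X [X_ind uX X_u X_large]] :=
    independent_nonneighbors conn G_gt1 leE (far _ E_small) (far _ n_quad5).
  exact: packing_from_star h_sym h_irr h_deg degen u_star X_ind uX X_u X_large.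
have few_leaves u : #|neighbors u :&: leaves| < d * (D + d + 1).
  move: no_star; rewrite negb_exists => /forallP/(_ u); rewrite -ltnNge.
  by congr (_ < _); apply: eq_card => v; rewrite !inE.
(* Both remaining cases are spread-set packings: with leaves, of degree 1 and
   fewer than d * (D + d + 1) around any vertex, or with an independent part of
   the low set, where degrees and spread are at most 2 and 4. *)
have [many|few] := leqP (d * (d * (D + d + 1))) #|leaves|.
  apply: (@packing_from_spread_set G W h d D
            1 (d * (D + d + 1)).-1 leaves) => //.
  - exact: leaves_independent.
  - by move=> v; rewrite inE => /eqP->.
  - by move=> u; have := few_leaves u; lia.
  - have /card_gt0P[x _] : 0 < #|G| by apply: ltnW.
    by rewrite add1n prednK // (leq_ltn_trans _ (few_leaves x)).
  - apply: leq_trans many; rewrite leq_mul2l.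
    case: (posnP d) => [->//|d_gt0]; apply/orP; right.
    by apply: leq_trans (leq_pmull _ d_gt0); rewrite -addnA leq_addr.
have low_large := card_low_set conn G_gt1 leE.
have [S [sS S_ind S_large]] := large_independent_set (low_set G).
(* The low set induces degrees at most 2, so [large_independent_set] keeps three
   tenths of it. *)
have low_sum : degree_sum (low_set G) <= 2 * #|low_set G|.
  rewrite mulnC -sum_nat_const; apply: leq_sum => x.
  rewrite inE => /andP[x2 _]; apply: leq_trans x2.
  exact/subset_leq_card/subsetIl.
have S_room : d * (D + 6) <= #|S| by rewrite -/n -/leaves in low_large; lia.
apply: (@packing_from_spread_set G W h d D 2 4 S) => //.
- by move=> x /(subsetP sS); rewrite inE => /andP[].
- move=> u; have [->|/set0Pn[x]] := eqVneq (neighbors u :&: S) set0.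
    by rewrite cards0.
  rewrite !inE => /andP[ux /(subsetP sS)].
  rewrite inE => /andP[_ /forallP/(_ u)].
  rewrite adj_sym ux /= => u4; apply: leq_trans u4.
  exact/subset_leq_card/subsetIl.
- by apply: leq_trans S_room; rewrite leq_mul2l leq_addl orbT.
- by apply: leq_trans S_room; rewrite leq_mul2l leq_addr orbT.
Qed.

(** * From packings to subgraphs *)

Definition nonadj (F : sgraph) : rel F := fun x y => (x != y) && ~~ adj x y.

Lemma min_degree_le (F : sgraph) (x : F) : min_degree F <= degree x.
Proof.
rewrite /min_degree; have := mem_index_enum x.
elim: (index_enum F) => //= y s IH; rewrite inE big_cons => /predU1P[<-|xs].
  exact: geq_minl.
exact: leq_trans (geq_minr _ _) (IH xs).
Qed.

Lemma card_nonadj (F : sgraph) (x : F) :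
  #|[set y | nonadj x y]| + degree x + 1 = #|F|.
Proof.
have -> : [set y | nonadj x y] = ~: (x |: neighbors x).
  by apply/setP => y; rewrite !inE negb_or eq_sym.
rewrite -(cardsC (x |: neighbors x)) cardsU1 inE adj_irrefl /=.
by rewrite -/(degree x); lia.
Qed.

Lemma contains_of_packing (F G : sgraph) (f : G -> F) :
  #|F| = #|G| -> packs_on (@adj G) (@nonadj F) setT f -> contains F G.
Proof.
move=> cFG [f_inj0 f_pack].
have f_inj : injective f by move=> x y; apply: f_inj0; rewrite inE.
pose img a b := [exists x, exists y, [&& f x == a, f y == b & adj x y]].
have imgE x y : img (f x) (f y) = adj x y.
  apply/existsP/idP => [[x' /existsP[y']]|xy].
    by case/and3P=> /eqP/f_inj-> /eqP/f_inj->.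
  by exists x; apply/existsP; exists y; rewrite !eqxx.
have img_sym : symmetric img.
  suff sub a b : img a b -> img b a by move=> a b; apply/idP/idP; apply: sub.
  case/existsP=> x /existsP[y /and3P[/eqP<- /eqP<- xy]].
  by rewrite imgE adj_sym.
have imgP a b : img a b -> [/\ a \in [set: F], b \in [set: F] & adj a b].
  case/existsP=> x /existsP[y /and3P[/eqP<- /eqP<- xy]]; split; rewrite ?inE //.
  have := f_pack x y (in_setT x) (in_setT y) xy; rewrite negb_and !negbK.
  case/orP=> // /eqP/f_inj xy'; by rewrite xy' adj_irrefl in xy.
pose H := Subgraph img_sym imgP; exists H.
pose f' x : graph_of_subgraph H := Sub (f x) (in_setT (f x)).
exists f' => [|x y]; last exact: imgE.
apply: inj_card_bij => [x y /(congr1 val)/f_inj //|].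
by rewrite card_sig -cFG; apply/eq_leq/eq_card => x; rewrite !inE.
Qed.

Local Open Scope ring_scope.

Theorem corollary2 (k n : nat)
  (hk : (1 <= k)%N)
  (hn : Num.max (6 * k%:R ^+ 3) (120 * k%:R ^+ 2 - 180 * k%:R + 60)
          <= n%:R :> rat)
  (F : sgraph) (hF : #|F| = n)
  (hdelta : n%:R - k%:R <= (min_degree F)%:R :> rat)
  (G : sgraph) (hG : #|G| = n) (hconn : connected G)
  (hedges : #|edges G|%:R <= n%:R * (1 + 1 / (24 * k%:R - 12)) :> rat)
  (hDelta : (max_degree G)%:R < n%:R * (1 - 1 / (24 * k%:R - 12)) :> rat) :
  contains F G.
Proof.
have [d kd] : exists d, k = d.+1 by exists k.-1; rewrite prednK.
rewrite {}kd {hk} in hn hdelta hedges hDelta; move: hn hdelta hedges hDelta.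
have -> : 24 * d.+1%:R - 12 = (12 * (2 * d + 1))%N%:R :> rat.
  by rewrite -natr1 !(natrD, natrM); ring.
set c := (12 * (2 * d + 1))%N.
have c_gt0 : 0 < c%:R :> rat by rewrite ltr0n /c; lia.
rewrite ge_max => /andP[hcubic hquad] hdelta hedges hDelta.
have n_cubic : (6 * (d + 1) ^ 3 <= n)%N.
  by rewrite -(ler_nat rat) natrM natrX addn1.
have n_quad : (60 * (2 * d + 1) * d <= n)%N.
  rewrite -(ler_nat rat); apply: le_trans hquad.
  by rewrite -natr1 !(natrD, natrM) le_eqVlt; apply/orP; left; apply/eqP; ring.
have F_deg (x : F) : (#|[set y | nonadj x y]| <= d)%N.
  have : (n <= min_degree F + d.+1)%N by rewrite -(ler_nat rat) natrD -lerBlDr.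
  by have := card_nonadj x; have := min_degree_le x; lia.
have G_deg (u : G) : (n < c * (n - degree u))%N.
  have : (max_degree G * c + n < n * c)%N.
    rewrite -(ltr_nat rat) natrD (natrM _ n) (natrM _ (max_degree G)).
    have -> : n%:R * c%:R = (n%:R * (1 - 1 / c%:R)) * c%:R + n%:R :> rat.
      by field; rewrite gt_eqF.
    by rewrite ltrD2r ltr_pM2r.
  by have := leq_bigmax (F := @degree G) u; rewrite -/(max_degree G); nia.
(* The number of edges is an integer, so its bound may be rounded down. *)
have edges_le : (#|edges G| <= n + n %/ c)%N.
  suff : (#|edges G| * c <= n * c + n)%N.
    have := ltn_ceil n (_ : 0 < c)%N; rewrite -(ltr_nat rat) c_gt0 => /(_ isT).
    by nia.
  rewrite -(ler_nat rat) natrD (natrM _ n) (natrM _ #|edges G|).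
  have -> : n%:R * c%:R + n%:R = (n%:R * (1 + 1 / c%:R)) * c%:R :> rat.
    by field; rewrite gt_eqF.
  by rewrite ler_pM2r.
have [f] : exists f : G -> F, packs_on (@adj G) (@nonadj F) setT f.
  apply: (@sparse_connected_packing G F (@nonadj F) d (n %/ c) hconn).
  - by rewrite hG; lia.
  - by rewrite hF hG.
  - by move=> x y; rewrite /nonadj eq_sym adj_sym.
  - by move=> x; rewrite /nonadj eqxx.
  - exact: F_deg.
  - by rewrite hG; have := sum_degree_le G; lia.
  - by rewrite hG mulnC; apply: leq_divM.
  - by rewrite hG; exact: n_cubic.
  - by rewrite hG; exact: n_quad.
  - by move=> u; rewrite hG; exact: G_deg.
by apply: contains_of_packing; rewrite hF hG.
Qed.
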